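(* Let $\mathbb{K}$ be an ordered field with powers from an ordered field $\Lambda$, and let $\mathfrak{M}$ be a multiplicatively written totally ordered $\Lambda$-vector space. Let $\mathcal{L}$ be a family of restricted power series with coefficients in $\mathbb{K}(\!(\mathfrak{M})\!)$, and suppose $\mathcal{L}$ is closed under formal partial derivatives and under coefficient-wise truncations. Then the smallest subring $R$ of $\mathbb{K}(\!(\mathfrak{M})\!)$ containing $\mathbb{K}\cup\mathfrak{M}$ and such that $f(a)\in R$ for every $f\in\mathcal{L}$ in $n$ variables and every $n$-tuple $a$ of infinitesimal elements of $R$, is closed under truncations.
   Context: An ordered field with powers from $\Lambda$: $(\mathbb{K}^{>0},\cdot)$ carries an ordered $\Lambda$-vector space structure written exponentially. $\mathbb{K}(\!(\mathfrak{M})\!)$ is the Hahn field of formal sums $\sum_{\mathfrak m}f_{\mathfrak m}\mathfrak m$ with support reverse well ordered; the truncation of $f$ at $\mathfrak m$ is $f|\mathfrak m=\sum_{\mathfrak n>\mathfrak m}f_{\mathfrak n}\mathfrak n$, and closed under truncations means containing all truncations of its elements. Infinitesimal elements are those with support $<1$, forming $\mathbb K(\!(\mathfrak M^{<1})\!)$. A restricted (infinitesimally convergent) power series in variables $x=(x_0,\ldots,x_{n-1})$ with coefficients in $\mathbb K(\!(\mathfrak M)\!)$ is a formal power series $f=\sum_{m\in\mathbb N^n}r_mx^m$ with $r_m\in\mathbb K(\!(\mathfrak M)\!)$ such that $\bigcup_m\mathrm{Supp}\, r_m$ is well ordered for the reverse order of $\mathfrak M$ (equivalently, an element of $\mathbb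 K(\!(\mathfrak M\times x^{\mathbb N})\!)$ with the product partial order). Its coefficient-wise truncation at $\mathfrak m$ is $f\|\mathfrak m=\sum_m(r_m|\mathfrak m)x^m$. Formal derivatives are $\partial_{x_i}$ computed termwise. For an $n$-tuple $a$ of infinitesimals, $f(a)=\sum_m r_ma^m$ (a summable family). *)

(* Defs.v *)
From HB Require Import structures.
From mathcomp Require Import all_boot all_order all_algebra finmap.
From mathcomp Require Import boolp classical_sets functions cardinality fsbigop.

Set Implicit Arguments.
Unset Strict Implicit.
Unset Printing Implicit Defensive.

Import Order.TTheory GRing.Theory Num.Theory.

Local Open Scope classical_set_scope.
Local Open Scope ring_scope.

(* [powF] is only constrained on the positive elements of the field: there the
   axioms say that the ordered group of positive elements, under
   multiplication, is an ordered vector space over [Lam] with [powF x a] as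
   the scalar multiple of [x] by [a].  Its values elsewhere are junk. *)
HB.mixin Record hasPowers (Lam : realFieldType) K of Num.RealField K := {
  powF : K -> Lam -> K;
  powF_gt0 : forall (x : K) (a : Lam), 0 < x -> 0 < powF x a;
  powF1 : forall x : K, 0 < x -> powF x 1 = x;
  powFD : forall (x : K) (a b : Lam),
    0 < x -> powF x (a + b) = powF x a * powF x b;
  powFA : forall (x : K) (a b : Lam),
    0 < x -> powF x (a * b) = powF (powF x a) b;
  powFM : forall (x y : K) (a : Lam),
    0 < x -> 0 < y -> powF (x * y) a = powF x a * powF y a;
  powF_gt1 : forall (x : K) (a : Lam), 0 < a -> 1 < x -> 1 < powF x a
}.

#[short(type="powFieldType")]
HB.structure Definition PowField (Lam : realFieldType) :=
  { K of Num.RealField K & hasPowers Lam K }.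

HB.mixin Record isOrderedLmodule (Lam : realFieldType) M
    of GRing.Lmodule Lam M & Num.POrderedZmodule M := {
  ole_total : total (<=%R : rel M);
  olerD2l : forall x y z : M, x <= y -> z + x <= z + y;
  oscale_gt0 : forall (a : Lam) (x : M), 0 < a -> 0 < x -> 0 < a *: x
}.

#[short(type="orderedLmodType")]
HB.structure Definition OrderedLmodule (Lam : realFieldType) :=
  { M of GRing.Lmodule Lam M & Num.POrderedZmodule M
       & isOrderedLmodule Lam M }.

Section ReverseWellOrdered.
Context {Lam : realFieldType} {M : orderedLmodType Lam}.
Implicit Types (A B : set M) (m x y z : M).

Lemma ocmp x y : x >=< y.
Proof. exact: ole_total. Qed.

Lemma oleNgt x y : (x <= y) = ~~ (y < x).
Proof. by apply: comparable_leNgt; exact: ocmp. Qed.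

Lemma oltNge x y : (x < y) = ~~ (y <= x).
Proof. by apply: comparable_ltNge; exact: ocmp. Qed.

Definition rwo A := forall B, B `<=` A -> B !=set0 ->
  exists2 m, B m & forall n, B n -> n <= m.

Lemma rwoS A B : rwo B -> A `<=` B -> rwo A.
Proof. by move=> rB AB C CA; apply: rB => x /CA/AB. Qed.

Lemma rwo0 : rwo set0.
Proof. by move=> B B0 [x /B0]. Qed.

Lemma rwo1 x : rwo [set x].
Proof. by move=> B Bx [y By]; exists y => // z /Bx ->; rewrite -(Bx _ By). Qed.

Lemma rwoU A B : rwo A -> rwo B -> rwo (A `|` B).
Proof.
move=> rA rB C CAB C0.
have [CA0|/nonemptyPn CA0] := pselect (C `&` A !=set0); last first.
  by apply: rB => // x Cx; case: (CAB _ Cx) => // Ax;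
     have : (C `&` A) x by []; rewrite CA0.
have [CB0|/nonemptyPn CB0] := pselect (C `&` B !=set0); last first.
  by apply: rA => // x Cx; case: (CAB _ Cx) => // Bx;
     have : (C `&` B) x by []; rewrite CB0.
have [|x [Cx Ax] xM] := rA (C `&` A) _ CA0; first by move=> x [].
have [|y [Cy By] yM] := rB (C `&` B) _ CB0; first by move=> ? [].
have [xy|yx] := comparable_leP (ocmp x y).
  exists y => // z Cz; case: (CAB _ Cz) => ?; last exact: yM.
  by apply: le_trans xy; apply: xM.
exists x => // z Cz; case: (CAB _ Cz) => ?; first exact: xM.
by apply: le_trans (ltW yx); apply: yM.
Qed.

Lemma olerD2r x y z : x <= y -> x + z <= y + z.
Proof. by rewrite ![_ + z]addrC; apply: olerD2l. Qed.

Lemma olerN x y : x <= y -> - y <= - x.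
Proof.
move=> /(@olerD2l Lam M _ _ (- y - x)).
by rewrite addrNK [- y - x]addrC addrNK.
Qed.

Lemma oltrD2r_lt x1 y1 x2 y2 : x1 + y1 < x2 + y2 -> x2 <= x1 -> y1 < y2.
Proof.
rewrite !oltNge => + x21; apply: contra => y21.
by apply: le_trans (olerD2l y2 y1 x2 y21) _; apply: olerD2r.
Qed.

Lemma rwoD A B : rwo A -> rwo B -> rwo [set x + y | x in A & y in B].
Proof.
move=> rA rB C CAB [c0 Cc0]; apply: contrapT => noM.
have up c : C c -> exists2 c', C c' & c < c'.
  move=> Cc; apply: contrapT => noc; apply: noM; exists c => // n Cn.
  by rewrite oleNgt; apply/negP => cn; apply: noc; exists n.
pose best c a := exists y, [/\ A a, B y, C (a + y), c < a + y &
  forall x' y', A x' -> B y' -> C (x' + y') -> c < x' + y' -> x' <= a].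
have ex_best c : C c -> exists a, best c a.
  move=> Cc; have [c' Cc' cc'] := up _ Cc.
  pose X := [set x | A x /\ exists y, [/\ B y, C (x + y) & c < x + y]].
  have XA : X `<=` A by move=> x [].
  have X0 : X !=set0.
    have [x Ax [y By xy]] := CAB _ Cc'; exists x; split=> //.
    by exists y; split=> //; rewrite xy.
  have [x [Ax [y [By Cxy cxy]]] xM] := rA X XA X0.
  exists x, y; split=> // x' y' Ax' By' Cx' cx'.
  by apply: xM; split=> //; exists y'.
pose S := [set y | B y /\ exists c x, [/\ C c, A x, C (x + y), c < x + y &
  forall x' y', A x' -> B y' -> C (x' + y') -> c < x' + y' -> x' <= x]].
have SB : S `<=` B by move=> y [].
have S0 : S !=set0.
  have [a [y [Aa By Cay cay aM]]] := ex_best _ Cc0.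
  by exists y; split=> //; exists c0, a.
have [y0 [By0 [c [x0 [Cc Ax0 Cx0 cx0 x0M]]]] y0M] := rB S SB S0.
have [x1 [y1 [Ax1 By1 C1 lt1 x1M]]] := ex_best _ Cx0.
have x10 : x1 <= x0 by apply: (x0M _ y1) => //; apply: lt_trans lt1.
have : y1 <= y0 by apply: y0M; split=> //; exists (x0 + y0), x1.
by rewrite oleNgt (oltrD2r_lt lt1 x10).
Qed.

Lemma rwo_convolution_finite A B m :
  rwo A -> rwo B -> finite_set [set n | A n /\ B (m - n)].
Proof.
move=> rA rB; set X := [set n | _]; apply: contrapT => Xinf.
have minX Y : Y `<=` X -> Y !=set0 -> exists2 n, Y n & forall k, Y k -> n <= k.
  move=> YX [y Yy].
  have mYB : [set m - n | n in Y] `<=` B by move=> _ [k /YX[_ Bk] <-].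
  have [|_ [n Yn <-] nM] := rB _ mYB; first by exists (m - y), y.
  exists n => // k Yk; have /nM/(@olerD2l Lam M _ _ (- m)) :
    [set m - n | n in Y] (m - k) by exists k.
  by rewrite !addKr => /olerN; rewrite !opprK.
pose up n := X `&` [set k | n <= k].
pose Y := [set n | X n /\ ~ finite_set (up n)].
have [n0 Xn0 n0min] : exists2 n, X n & forall k, X k -> n <= k.
  apply: minX => //; apply/set0P/negP => /eqP X0.
  by apply: Xinf; rewrite X0; exact: finite_set0.
have YA : Y `<=` A by move=> n [[]].
have Y0 : Y !=set0.
  exists n0; split=> //; rewrite (_ : up n0 = X)//.
  by apply/seteqP; split=> [k []//|k Xk]; split=> //; apply: n0min.
have [n [Xn ninf] nM] := rA Y YA Y0.
have lt_up : (up n `\ n) !=set0.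
  apply/set0P/negP => /eqP /(congr1 (setU [set n])).
  rewrite setU0 setDUK; last by move=> _ ->; split=> /=.
  by move=> upn; apply: ninf; rewrite upn; exact: finite_set1.
have [z [[Xz nz] /= zn] zmin] : exists2 z, (up n `\ n) z &
    forall k, (up n `\ n) k -> z <= k by apply: minX => // k [[]].
have upz : up n `\ n `<=` up z by move=> k Uk; split; [case: Uk => -[]|exact: zmin].
have Yz : Y z.
  split=> //; apply: contra_not ninf => /(sub_finite_set upz) fin.
  apply: sub_finite_set (_ : finite_set ((up n `\ n) `|` [set n])); last first.
    by rewrite finite_setU; split.
  by move=> k Uk; have [->|kn] := eqVneq k n; [right|left; split=> //; exact/eqP].
by apply: zn; apply/le_anti; rewrite nM.
Qed.

End ReverseWellOrdered.

Arguments rwo1 {Lam M} x B _ _.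

(* The Hahn series over the field [K] with monomials in [M].  The group of
   monomials is written additively: the monomial 1 is [0 : M], the product of
   two monomials is their sum in [M], and [a *: m] is the power of [m] with
   exponent [a]. *)
Section HahnSeries.
Context {Lam : realFieldType} (K : realFieldType) (M : orderedLmodType Lam).

Definition supp (f : M -> K) : set M := [set m | f m != 0].

Record hahn := Hahn { coef :> M -> K; rwo_supp : rwo (supp coef) }.

Arguments rwo_supp : clear implicits.

HB.instance Definition _ := gen_eqMixin hahn.
HB.instance Definition _ := gen_choiceMixin hahn.

Implicit Types (f g h : hahn) (m n : M) (c : K).

Lemma hahnP f g : f =1 g -> f = g.
Proof.
case: f g => [f rf] [g rg] /= /funext fg; rewrite fg in rf *.
by congr Hahn; exact: Prop_irrelevance.
Qed.

Lemma term_subproof c m : rwo (supp (fun n => if n == m then c else 0)).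
Proof.
by apply: rwoS (rwo1 m) _ => n; rewrite /supp /=; have [->|_] := eqVneq n m; rewrite ?eqxx.
Qed.

Definition term c m := Hahn (@term_subproof c m).

Definition hconst c := term c 0.
Definition monomial m := term 1 m.

Lemma hzero_subproof : rwo (supp (fun=> 0)).
Proof. by apply: rwoS rwo0 _ => n; rewrite /supp /= eqxx. Qed.

Lemma hopp_subproof f : rwo (supp (fun m => - f m)).
Proof. by apply: rwoS (rwo_supp f) _ => n; rewrite /supp /= oppr_eq0. Qed.

Lemma hadd_subproof f g : rwo (supp (fun m => f m + g m)).
Proof.
apply: rwoS (rwoU (rwo_supp f) (rwo_supp g)) _ => n; rewrite /supp /=.
by have [->|fn] := eqVneq (f n) 0; [rewrite add0r; right|left].
Qed.

Definition hzero := Hahn (@hzero_subproof).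
Definition hopp f := Hahn (@hopp_subproof f).
Definition hadd f g := Hahn (@hadd_subproof f g).

Fact haddA : associative hadd.
Proof. by move=> f g h; apply: hahnP => m /=; rewrite addrA. Qed.
Fact haddC : commutative hadd.
Proof. by move=> f g; apply: hahnP => m /=; rewrite addrC. Qed.
Fact hadd0 : left_id hzero hadd.
Proof. by move=> f; apply: hahnP => m /=; rewrite add0r. Qed.
Fact haddN : left_inverse hzero hopp hadd.
Proof. by move=> f; apply: hahnP => m /=; rewrite addNr. Qed.

HB.instance Definition _ := GRing.isZmodule.Build hahn haddA haddC hadd0 haddN.

(* The sum has finitely many nonzero terms, by [conv_finite]. *)
Definition conv f g m : K := \sum_(n \in [set: M]) f n * g (m - n).

Lemma conv_finite f g m : finite_set [set n | supp f n /\ supp g (m - n)].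
Proof. by apply: rwo_convolution_finite; exact: rwo_supp. Qed.

Lemma convE f g m (s : seq M) : uniq s ->
    (forall n, supp f n -> supp g (m - n) -> n \in s) ->
  conv f g m = \sum_(n <- s) f n * g (m - n).
Proof.
move=> us fgs; rewrite /conv (fsbigE s) //.
  by apply: eq_bigl => n; rewrite in_setT.
move=> n _; apply: contraNeq; rewrite mulf_eq0 negb_or => /andP[fn gn].
exact: fgs.
Qed.

Lemma fsum_neq0 (I : choiceType) (F : I -> K) :
  \sum_(i \in [set: I]) F i != 0 -> exists i, F i != 0.
Proof.
apply: contra_neqP => /forallNP F0; apply: fsbig1 => i _.
by apply/eqP; apply: contrapT => /negP; exact: F0.
Qed.

Lemma supp_conv f g : supp (conv f g) `<=`
  [set x + y | x in supp f & y in supp g].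
Proof.
move=> m /fsum_neq0[n]; rewrite mulf_eq0 negb_or => /andP[fn gn].
by exists n => //; exists (m - n) => //; rewrite addrC subrK.
Qed.

Lemma conv_subproof f g : rwo (supp (conv f g)).
Proof.
exact: rwoS (rwoD (rwo_supp f) (rwo_supp g)) (@supp_conv f g).
Qed.

Definition hmul f g := Hahn (@conv_subproof f g).

Fact hmulC : commutative hmul.
Proof.
move=> f g; apply: hahnP => m /=; rewrite /conv.
have mK : involutive (fun n => m - n) by move=> n; rewrite opprB addrC subrK.
rewrite (reindex_fsbigT (fun n => m - n)); last exact: inv_bij.
by apply: eq_fsbigr => n _; rewrite mK mulrC.
Qed.

Fact hmulA : associative hmul.
Proof.
move=> f g h; apply: hahnP => m /=.
have finN := rwo_convolution_finite m (rwo_supp f)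
  (rwoD (rwo_supp g) (rwo_supp h)).
have finL := rwo_convolution_finite m
  (rwoD (rwo_supp f) (rwo_supp g)) (rwo_supp h).
pose N := fset_set [set n | supp f n /\
  [set x + y | x in supp g & y in supp h] (m - n)].
pose L := fset_set [set l | [set x + y | x in supp f & y in supp g] l /\
  supp h (m - l)].
have NP n : supp f n -> [set x + y | x in supp g & y in supp h] (m - n) ->
  n \in N by move=> fn ghn; rewrite in_fset_set// inE.
have LP l : [set x + y | x in supp f & y in supp g] l -> supp h (m - l) ->
  l \in L by move=> fgl hl; rewrite in_fset_set// inE.
have convg n : conv g h (m - n) = \sum_(l \in [set: M]) g (l - n) * h (m - l).
  rewrite /conv (reindex_fsbigT (fun l => l - n)); last first.
    by exists (fun l => l + n) => l; rewrite ?addrK ?subrK.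
  by apply: eq_fsbigr => l _; rewrite opprB subrKA.
rewrite (@convE f (hmul g h) _ N) ?fset_uniq//; last first.
  by move=> n fn /supp_conv; exact: NP.
rewrite (@convE (hmul f g) h _ L) ?fset_uniq//; last first.
  by move=> l /supp_conv; exact: LP.
have lhs n : n \in N -> f n * (hmul g h) (m - n) =
    \sum_(l <- L) f n * g (l - n) * h (m - l).
  rewrite in_fset_set// inE => -[fn _].
  rewrite /= convg (fsbigE L) ?fset_uniq//; last first.
    move=> l _; apply: contraNeq; rewrite mulf_eq0 negb_or => /andP[gl hl].
    by apply: LP => //; exists n => //; exists (l - n) => //; rewrite addrC subrK.
  rewrite big_distrr; apply: eq_big => [l|l _]; first by rewrite in_setT.
  by rewrite /= mulrA.
rewrite (eq_big_seq _ lhs) exchange_big; apply: eq_big_seq => l.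
rewrite in_fset_set// inE => -[_ hl]; rewrite -big_distrl /=; congr (_ * _).
rewrite (@convE f g l N) ?fset_uniq// => n fn gn; apply: NP => //.
exists (l - n) => //; exists (m - l) => //.
by rewrite addrC subrKA.
Qed.

Fact hmul1 : left_id (hconst 1) hmul.
Proof.
move=> f; apply: hahnP => m /=; rewrite (@convE (hconst 1) f m [:: 0])//.
  by rewrite big_seq1 /= eqxx mul1r subr0.
by move=> n; rewrite /supp inE /=; have [->|_] := eqVneq n 0; rewrite ?eqxx.
Qed.

Fact hmulDl : left_distributive hmul hadd.
Proof.
move=> f g h; apply: hahnP => m /=.
have := rwo_convolution_finite m (rwoU (rwo_supp f) (rwo_supp g)) (rwo_supp h).
move=> finN; pose N := fset_set
  [set n | (supp f `|` supp g) n /\ supp h (m - n)].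
have NP n : (supp f `|` supp g) n -> supp h (m - n) -> n \in N.
  by move=> fn hn; rewrite in_fset_set// inE.
rewrite (@convE (hadd f g) h m N) ?fset_uniq//; last first.
  move=> n; rewrite /supp /= => fgn hn; apply: NP => //.
  move: fgn; rewrite /supp /=.
  by have [->|fn] := eqVneq (f n) 0; [rewrite add0r; right|left].
rewrite (@convE f h m N) ?fset_uniq//; last by move=> n fn; apply: NP; left.
rewrite (@convE g h m N) ?fset_uniq//; last by move=> n gn; apply: NP; right.
by rewrite -big_split; apply: eq_bigr => n _; rewrite /= mulrDl.
Qed.

Fact hone_neq0 : hconst 1 != 0.
Proof.
by apply/eqP => /(congr1 (fun f => f 0)) /= /eqP; rewrite eqxx oner_eq0.
Qed.

HB.instance Definition _ := GRing.Zmodule_isComNzRing.Build hahn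
  hmulA hmulC hmul1 hmulDl hone_neq0.

Lemma truncation_subproof f m : rwo (supp (fun n => if m < n then f n else 0)).
Proof.
by apply: rwoS (rwo_supp f) _ => n; rewrite /supp /=; case: ifP => // _; rewrite eqxx.
Qed.

Definition truncation f m := Hahn (@truncation_subproof f m).

Definition infinitesimal f := supp f `<=` [set m | m < 0].

Definition closed_under_truncation (S : set hahn) :=
  forall f m, S f -> S (truncation f m).

Section Summable.
Context {I : choiceType}.
Implicit Type F : I -> hahn.

Definition summable F :=
  rwo (\bigcup_i supp (F i)) /\ forall m, finite_set [set i | supp (F i) m].

Lemma hsum_subproof F : summable F ->
  rwo (supp (fun m => \sum_(i \in [set: I]) F i m)).
Proof.
move=> [rF _]; apply: rwoS rF _ => m /fsum_neq0[i Fim].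
by exists i.
Qed.

(* The value 0 on families that are not summable is junk; the families arising
   from restricted power series at infinitesimal arguments are summable. *)
Definition hsum F : hahn :=
  if pselect (summable F) is left sF then Hahn (@hsum_subproof _ sF) else 0.

End Summable.

(* [r m] is the coefficient of the monomial whose exponent in the [i]-th
   variable is [m i]. *)
Definition pseries (n : nat) := {ffun 'I_n -> nat} -> hahn.

Section PowerSeries.
Context {n : nat}.
Implicit Types (r : pseries n) (a : 'I_n -> hahn).

Definition restricted r := rwo (\bigcup_m supp (r m)).

Definition pderiv (i : 'I_n) r : pseries n :=
  fun m : {ffun 'I_n -> nat} => r [ffun j => (m j + (j == i))%N] *+ (m i).+1.

Definition ptruncation r (k : M) : pseries n :=
  fun m : {ffun 'I_n -> nat} => truncation (r m) k.

Definition peval r a : hahn :=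
  hsum (fun m : {ffun 'I_n -> nat} => r m * \prod_i a i ^+ m i).

End PowerSeries.

Section Family.
Variable L : forall n : nat, set (pseries n).

Definition closed_under_pderiv :=
  forall (n : nat) (i : 'I_n) r, L r -> L (pderiv i r).

Definition closed_under_ptruncation :=
  forall (n : nat) (r : pseries n) k, L r -> L (ptruncation r k).

Definition closed_under_peval (S : set hahn) :=
  forall (n : nat) (r : pseries n) (a : 'I_n -> hahn), L r ->
    (forall i, S (a i) /\ infinitesimal (a i)) -> S (peval r a).

Definition generated_subring : set hahn :=
  smallest [set S : set hahn | subring_closed (mem S) /\ closed_under_peval S]
           (range hconst `|` range monomial).

End Family.
End HahnSeries.

Arguments rwo_supp {Lam K M} h B _ _.

(* Main.v *)
Require Import Defs.
From mathcomp Require Import all_boot all_order all_algebra finmap.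
From mathcomp Require Import boolp classical_sets functions cardinality fsbigop.

(* The elements of R all of whose truncations lie in R form a subring S, so it
   is enough that S be closed under evaluation of the series r of L.  Truncate
   r(a) at m, by induction first on the cuts of the arguments a_i and then on
   the cut of the coefficients of r.  If s + k n > m for all s in the supports of
   the coefficients, n in the supports of the a_i and k in nat, then r(a) lies
   entirely above m.  If s + N n <= m for such s and n, with n in the support of
   a_i, write r = r||s + g and a_i = b + d with b = a_i|n.  (If s <= m already,
   no n is needed and g(a) has truncation 0.)  The first summand is handled by
   the induction on r.  The coefficients of g are <= s and d <= n, so
   up to terms <= m the Taylor expansion of g(a) in d stops before order N; its
   coefficients are values of derivatives at arguments with b in place of a_i,
   to which the induction on a applies.  Evaluation is summable by Neumann's
   lemma, again proved by induction on cuts. *)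

Set Implicit Arguments.
Unset Strict Implicit.
Unset Printing Implicit Defensive.

Import Order.TTheory GRing.Theory Num.Theory.

Local Open Scope classical_set_scope.
Local Open Scope ring_scope.

(** * Sums of words in negative monomials, and Neumann's lemma *)

Section OrderedMonomials.
Context {Lam : realFieldType} {M : orderedLmodType Lam}.
Implicit Types (A X : set M) (x y z n s v : M) (w : seq M).

Lemma olerD x y z t : x <= y -> z <= t -> x + z <= y + t.
Proof. by move=> xy /(olerD2l z t y); apply: le_trans; apply: olerD2r. Qed.

Lemma oltrD2l z x y : x < y -> z + x < z + y.
Proof.
rewrite !lt_neqAle => /andP[nxy xy]; rewrite olerD2l// andbT.
by apply: contra nxy => /eqP /addrI ->.
Qed.

Lemma olerMn n k l : n <= 0 -> (k <= l)%N -> n *+ l <= n *+ k.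
Proof.
move=> n0 /subnKC <-; rewrite mulrnDr -[leRHS]addr0; apply: olerD2l.
elim: (l - k)%N => [|j IH]; first by rewrite mulr0n.
by rewrite mulrS -[leRHS]addr0; apply: olerD.
Qed.

(** Each letter [<= n] contributes at most [n], every other letter at most 0. *)
Lemma oler_sum_count n w : (forall x, x \in w -> x <= 0) ->
  \sum_(x <- w) x <= n *+ count (fun x => x <= n) w.
Proof.
elim: w => [|x w IH] w0; first by rewrite big_nil mulr0n.
rewrite big_cons /= mulrnDr; apply: olerD; last first.
  by apply: IH => y yw; apply: w0; rewrite inE yw orbT.
have [xn|_] := boolP (x <= n); first by rewrite mulr1n.
by rewrite mulr0n; apply: w0; rewrite inE eqxx.
Qed.

Lemma oltr_sum_lt0 w : (forall x, x \in w -> x < 0) -> w != [::] ->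
  \sum_(x <- w) x < 0.
Proof.
case: w => // x w w0 _; rewrite big_cons.
apply: (@le_lt_trans _ _ (x + 0)); last by rewrite addr0 w0 ?inE ?eqxx.
apply: olerD2l; rewrite -[leRHS](mul0rn M (count (fun x => x <= 0) w)).
by apply: oler_sum_count => y yw; apply/ltW/w0; rewrite inE yw orbT.
Qed.

Lemma seq_min w : w != [::] -> exists2 n, n \in w & forall x, x \in w -> n <= x.
Proof.
elim: w => // x [|y w] IH _.
  by exists x; rewrite ?inE // => z; rewrite inE => /eqP ->.
have [//|n nw nmin] := IH.
have [xn|nx] := comparable_leP (ocmp x n).
  exists x; rewrite ?inE ?eqxx // => z; rewrite inE => /orP[/eqP->//|/nmin].
  exact: le_trans.
exists n; first by rewrite inE nw orbT.
by move=> z; rewrite inE => /orP[/eqP->|/nmin//]; exact: ltW.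
Qed.

Lemma seq_min_sum w : w != [::] ->
  exists2 n, n \in w & n *+ size w <= \sum_(x <- w) x.
Proof.
move=> /seq_min[n nw nmin]; exists n => //.
elim: w {nw} nmin => [|x w IH] nmin; first by rewrite big_nil mulr0n.
rewrite big_cons /= mulrS; apply: olerD; first by apply: nmin; rewrite inE eqxx.
by apply: IH => y yw; apply: nmin; rewrite inE yw orbT.
Qed.

Definition words X : set (seq M) := [set w | forall x, x \in w -> X x].

(** In multiplicative terms, [A] times the monoid generated by [X]. *)
Definition wordsum A X := [set s + \sum_(x <- w) x | s in A & w in words X].

Definition short_wordsum A X k :=
  [set v | exists s w, [/\ A s, words X w, (size w <= k)%N &
                         s + \sum_(x <- w) x = v]].

(** Induction on [k] for all [A] at once: the first letter of a word is absorbed into the head,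
    which replaces [A] by [A + X]. *)
Lemma rwo_short_wordsum A X k : rwo A -> rwo X -> rwo (short_wordsum A X k).
Proof.
move=> rA rX; elim: k A rA => [|k IH] A rA.
  apply: rwoS rA _ => v [s [w [As _ + <-]]].
  by rewrite leqn0 size_eq0 => /eqP ->; rewrite big_nil addr0.
apply: rwoS (rwoU rA (IH _ (rwoD rA rX))) _ => v [s [[|x w] [As wX sw <-]]].
  by left; rewrite big_nil addr0.
right; exists (s + x), w; split=> //.
- by exists s => //; exists x => //; apply: wX; rewrite inE eqxx.
- by move=> y yw; apply: wX; rewrite inE yw orbT.
- by rewrite big_cons addrA.
Qed.

Definition above n := [set x : M | n < x].

(** More than [k] letters [<= n] would bring the sum strictly below [s + n *+ k], hence below [v].
    So at most [k] letters are [<= n]; they join the head [s1], and [w2] keeps the letters above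
    [n]. *)
Lemma word_split A X n k s v s' w : X `<=` [set x | x < 0] -> n < 0 ->
  s + n *+ k <= v -> s' <= s -> A s' -> words X w ->
  v <= s' + \sum_(x <- w) x ->
  exists s1 w2, [/\ short_wordsum A X k s1, words (X `&` above n) w2,
    (size w <= k + size w2)%N & s' + \sum_(x <- w) x = s1 + \sum_(x <- w2) x].
Proof.
move=> Xneg n0 skv s's As' wX vsw.
have cnt : (count (fun x => x <= n)%R w <= k)%N.
  rewrite leqNgt; apply/negP => kc.
  have: s' + \sum_(x <- w) x < v; last by rewrite oltNge vsw.
  apply: lt_le_trans skv.
  apply: (@le_lt_trans _ _ (s + n *+ count (fun x => x <= n) w)).
    by apply: olerD s's _; apply: oler_sum_count => x /wX /Xneg /ltW.
  apply: oltrD2l; apply: le_lt_trans (olerMn (ltW n0) kc) _.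
  by rewrite mulrS -[ltRHS]add0r ![_ + n *+ k]addrC; apply: oltrD2l.
exists (s' + \sum_(x <- w | x <= n) x), [seq x <- w | ~~ (x <= n)]; split.
- exists s', [seq x <- w | x <= n]; rewrite big_filter size_filter; split=> //.
  by move=> x; rewrite mem_filter => /andP[_ /wX].
- move=> x; rewrite mem_filter => /andP[xn /wX Xx]; split=> //=.
  by rewrite /above /= oltNge.
- rewrite size_filter -(count_predC (fun x => x <= n)%R w).
  by rewrite leq_add2r.
- by rewrite big_filter -addrA [in LHS](bigID (fun x => x <= n)).
Qed.

(* The bound on the lengths is what makes families of power series terms
   pointwise finite. *)
Definition neumann X := forall A, rwo A -> rwo (wordsum A X) /\
  forall v, exists N, forall s w, A s -> words X w ->
    s + \sum_(x <- w) x = v -> (size w <= N)%N.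

(* Given a subset [B] of [wordsum A X], let [s + w] be an element of [B] with [s]
   maximal, and let [n] be the least letter of [w].  The elements of [B] above
   [s + w] use at most [size w] letters [<= n], so that they lie in
   [short_wordsum A X (size w)] plus words in letters above [n]. *)
Lemma neumann_step X : rwo X -> X `<=` [set x | x < 0] ->
  (forall n, X n -> neumann (X `&` above n)) -> neumann X.
Proof.
move=> rX Xneg IH A rA.
have best (B : set M) : B !=set0 -> B `<=` wordsum A X -> exists s w,
    [/\ A s, words X w, B (s + \sum_(x <- w) x) & forall s' w',
      A s' -> words X w' -> B (s' + \sum_(x <- w') x) -> s' <= s].
  move=> [b Bb] BAX.
  pose C := [set s | A s /\ exists w, words X w /\ B (s + \sum_(x <- w) x)].
  have [||s [As [w [wX Bsw]]] smax] := rA C.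
  - by move=> s [].
  - have [s As [w wX sw]] := BAX _ Bb.
    by exists s; split=> //; exists w; rewrite sw.
  exists s, w; split=> // s' w' As' w'X Bs'; apply: smax.
  by split=> //; exists w'.
split=> [B BAX B0|v].
  have [s [w [As wX Bv smax]]] := best B B0 BAX.
  have [w0|wn0] := eqVneq w [::].
    exists (s + \sum_(x <- w) x) => // v' Bv'.
    have [s' As' [w' w'X v'E]] := BAX _ Bv'; rewrite -v'E in Bv' *.
    rewrite w0 big_nil; apply: olerD; first exact: smax Bv'.
    rewrite -[leRHS](mul0rn M (count (fun x => x <= 0) w')).
    by apply: oler_sum_count => x /w'X /Xneg /ltW.
  have [n nw nsum] := seq_min_sum wn0.
  have Xn := wX _ nw.
  have [rAX _] := IH n Xn _ (rwo_short_wordsum (k := size w) rA rX).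
  set v := s + _ in Bv.
  have [||m [Bm vm] mmax] := rAX (B `&` [set v' | v <= v']).
  - move=> v' [Bv' /= vv']; have [s' As' [w' w'X v'E]] := BAX _ Bv'.
    rewrite -v'E in Bv' vv' *.
    have [s1 [w2 [s1A w2X _ ->]]] := word_split Xneg (Xneg _ Xn)
      (olerD2l _ _ s nsum) (smax _ _ As' w'X Bv') As' w'X vv'.
    by exists s1 => //; exists w2.
  - by exists v; split=> /=.
  exists m => // v' Bv'.
  have [vv'|v'v] := comparable_leP (ocmp v v'); first exact: mmax.
  exact: le_trans (ltW v'v) vm.
have [Av|nAv] := pselect (wordsum A X v); last first.
  exists 0%N => s w As wX sw; exfalso; apply: nAv.
  by exists s => //; exists w.
(* The length bound at [v] follows the same pattern, with the one-point set [[set v]] in the role of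
   [B]. *)
have [||s [w [As wX /= sw smax]]] := best [set v].
- by exists v.
- by move=> _ ->.
(* If the word with maximal head [s] is empty, then [v = s], and a nonempty word would give
   [v < s' <= s]. *)
have [w0|wn0] := eqVneq w [::].
  exists 0%N => s' w' As' w'X s'w'; rewrite leqn0 size_eq0.
  apply: contraTT isT => w'n0; have s's := smax _ _ As' w'X s'w'.
  have: s' + \sum_(x <- w') x < s' + 0.
    by apply: oltrD2l; apply: oltr_sum_lt0 w'n0 => x /w'X /Xneg.
  by rewrite s'w' -sw w0 big_nil !addr0 oltNge s's.
have [n nw nsum] := seq_min_sum wn0.
have Xn := wX _ nw.
have [_ /(_ v)[N NP]] := IH n Xn _ (rwo_short_wordsum (k := size w) rA rX).
exists (size w + N)%N => s' w' As' w'X s'w'.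
have snv : s + n *+ size w <= v by rewrite -sw; exact: olerD2l nsum.
have vs'w' : v <= s' + \sum_(x <- w') x by rewrite s'w'.
have [s1 [w2 [s1A w2X sz s1w2]]] := word_split Xneg (Xneg _ Xn)
  snv (smax _ _ As' w'X s'w') As' w'X vs'w'.
apply: leq_trans sz _; rewrite leq_add2l; apply: NP s1A w2X _.
by rewrite -s1w2.
Qed.

(** By [neumann_step] only the tails of [X] matter. If some tail fails, let [m] be the largest point
    of [X] above which it does. The tails of that tail are tails of [X] above points [k > m], so
    [neumann_step] contradicts the failure at [m]. *)
Lemma neumann_negative X : rwo X -> X `<=` [set x | x < 0] -> neumann X.
Proof.
move=> rX Xneg; apply: (neumann_step rX Xneg) => n Xn; apply: contrapT => nP.
pose bad := [set x | X x /\ ~ neumann (X `&` above x)].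
have [||m [Xm badm] mmax] := rX bad; [by move=> x []|by exists n|].
apply: badm; apply: neumann_step => [||k [Xk mk]].
- by apply: rwoS rX _ => x [].
- by move=> x [/Xneg].
have <- : X `&` above k = X `&` above m `&` above k.
  apply/seteqP; split=> x; last by move=> [[]].
  by move=> [Xx kx]; do !split=> //; exact: lt_trans mk kx.
apply: contrapT => badk; have: k <= m by apply: mmax.
by rewrite oleNgt mk.
Qed.

End OrderedMonomials.

(** * Well-foundedness of cuts *)

Section Cuts.
Context {Lam : realFieldType} {M : orderedLmodType Lam} {T : Type}.
Variables (cut : T -> M -> T) (sup : T -> set M).
Hypothesis sup_cut : forall x n, sup (cut x n) `<=` sup x `&` above n.
Hypothesis cut_cut : forall x n m, n <= m -> cut (cut x n) m = cut x m.

(** Cutting only at points of the support lets the reverse well-ordering act on the cut points. The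
    relation serves Hahn series and, with coefficient-wise cuts, power series. *)
Definition proper_cut y x := exists2 n, sup x n & y = cut x n.

(** If some proper cut of [x] is not accessible, take the largest such cut point [m]. A proper cut
    of [cut x m] is [cut x k] for some [k > m] in the support of [x], and is accessible by
    maximality. *)
Lemma Acc_proper_cut x : rwo (sup x) -> Acc proper_cut x.
Proof.
move=> rx; constructor => _ [n xn ->]; apply: contrapT => nAcc.
pose bad := [set m | sup x m /\ ~ Acc proper_cut (cut x m)].
have [||m [xm badm] mmax] := rx bad; [by move=> ? []|by exists n|].
apply: badm; constructor => _ [k /sup_cut[xk mk] ->].
have {}mk : m < k := mk.
rewrite (cut_cut _ (ltW mk)); apply: contrapT => badk.
by have := mmax k (conj xk badk); rewrite oleNgt mk.
Qed.

End Cuts.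

(** * Well-founded induction on tuples, one coordinate at a time *)

Section Update.
Context {I : finType} {T : Type}.
Variable R : T -> T -> Prop.
Implicit Types (a b : I -> T) (i : I).

Definition upd a i y : I -> T := fun j => if j == i then y else a j.

Definition upd_rel (s : seq I) b a :=
  exists i y, [/\ i \in s, R y (a i) & b = upd a i y].

(** Lexicographic nesting: for coordinates [i :: s], an outer induction on the value at [i] encloses
    an inner one along [s]. A change at [i] falls under the outer hypothesis, which allows all
    accessible values elsewhere. *)
Lemma Acc_upd_rel a : (forall i, Acc R (a i)) -> Acc (upd_rel (enum I)) a.
Proof.
elim: (enum I) a => [|i s IH] a aP.
  by constructor => b [i [y []]].
have [x ax] : exists x, x = a i by exists (a i).
have := aP i; rewrite -ax => xP.
elim: xP a aP {ax} (esym ax) => {}x _ IHx a aP.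
have accA := IH a aP.
elim: accA aP => {}a _ IHa aP ax.
constructor => b [j [y [js ya ->]]].
have bP k : Acc R (upd a j y k).
  rewrite /upd; case: eqP => _; last exact: aP.
  exact: Acc_inv (aP j) _ ya.
have [ji|ji] := eqVneq j i.
  by apply: (IHx y) => //; [rewrite -ax -ji|rewrite /upd ji eqxx].
apply: IHa => //; last by rewrite /upd eq_sym (negPf ji).
by exists j, y; split=> //; move: js; rewrite inE (negPf ji).
Qed.

End Update.

(** * Truncations of Hahn series, and their behaviour in a subring *)

Section Hahn.
Context {Lam : realFieldType} {K : realFieldType} {M : orderedLmodType Lam}.
Notation H := (hahn K M).
Implicit Types (f g h : H) (m n v : M) (A X : set M).

Lemma hcoef_sum (J : Type) (s : seq J) (P : pred J) (F : J -> H) m :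
  (\sum_(j <- s | P j) F j) m = \sum_(j <- s | P j) F j m.
Proof. by apply: (big_morph (fun f : H => f m)). Qed.

Lemma hcoefMn f k m : (f *+ k) m = f m *+ k.
Proof. by elim: k => [//|k IH]; rewrite !mulrS -IH. Qed.

Lemma truncationD f g m : truncation (f + g) m = truncation f m + truncation g m.
Proof. by apply: hahnP => n /=; case: ifP => // _; rewrite addr0. Qed.

Lemma truncationB f g m : truncation (f - g) m = truncation f m - truncation g m.
Proof. by apply: hahnP => n /=; case: ifP => // _; rewrite subr0. Qed.

Lemma truncation0 m : truncation (0 : H) m = 0.
Proof. by apply: hahnP => n /=; case: ifP. Qed.

Lemma truncation_sum (J : Type) (s : seq J) (P : pred J) (F : J -> H) m :
  truncation (\sum_(j <- s | P j) F j) m =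
  \sum_(j <- s | P j) truncation (F j) m.
Proof.
apply: (big_morph (fun f : H => truncation f m)); last exact: truncation0.
by move=> f g; rewrite truncationD.
Qed.

Lemma truncation_truncation f n m : n <= m ->
  truncation (truncation f n) m = truncation f m.
Proof.
move=> nm; apply: hahnP => v /=; case: ifP => // mv.
by rewrite (le_lt_trans nm mv).
Qed.

Lemma truncation_eq0 f m : (forall v, supp f v -> v <= m) -> truncation f m = 0.
Proof.
move=> fm; apply: hahnP => v /=; case: ifP => // mv.
by apply: contraTeq mv => /fm; rewrite oleNgt.
Qed.

Lemma truncation_id f m : supp f `<=` above m -> truncation f m = f.
Proof.
move=> fm; apply: hahnP => v /=; case: ifP => // mv.
by apply/esym; apply: contraFeq mv => /fm.
Qed.

Lemma supp_truncation f m : supp (truncation f m) `<=` supp f `&` above m.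
Proof. by move=> v; rewrite /supp /above /=; case: ifP; rewrite ?eqxx. Qed.

Lemma supp_sub_truncation f m v : supp (f - truncation f m) v ->
  supp f v /\ v <= m.
Proof.
rewrite /supp /= oleNgt; case: ifP => _; first by rewrite subrr eqxx.
by rewrite subr0.
Qed.

Lemma supp_mul f g : supp (f * g) `<=`
  [set x + y | x in supp f & y in supp g].
Proof. exact: supp_conv. Qed.

Lemma infinitesimal_truncation f m :
  infinitesimal f -> infinitesimal (truncation f m).
Proof. by move=> fi v /supp_truncation[/fi]. Qed.

Lemma Acc_truncation f : Acc (proper_cut (@truncation _ K M) (fun f : H => supp f)) f.
Proof.
apply: Acc_proper_cut; first exact: supp_truncation.
  exact: truncation_truncation.
exact: rwo_supp.
Qed.

Lemma hconstMn (c : K) k : hconst M (c *+ k) = hconst M c *+ k.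
Proof.
by apply: hahnP => v; rewrite hcoefMn /=; case: ifP => // _; rewrite mul0rn.
Qed.

Section Subring.
Variable R : set H.
Hypothesis R_subring : subring_closed (mem R).

Lemma subring1 : R 1.
Proof. by have [R1 _ _] := R_subring; have := R1; rewrite in_setE. Qed.

Lemma subringB f g : R f -> R g -> R (f - g).
Proof.
have [_ RB _] := R_subring => Rf Rg.
by have := RB f g; rewrite !in_setE; apply.
Qed.

Lemma subringM f g : R f -> R g -> R (f * g).
Proof.
have [_ _ RM] := R_subring => Rf Rg.
by have := RM f g; rewrite !in_setE; apply.
Qed.

Lemma subring0 : R 0.
Proof. by rewrite -(subrr 1); apply: subringB; exact: subring1. Qed.

Lemma subringD f g : R f -> R g -> R (f + g).
Proof.
move=> Rf Rg; rewrite -[g]opprK; apply: subringB => //.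
by rewrite -sub0r; apply: subringB => //; exact: subring0.
Qed.

Lemma subring_sum (J : Type) (s : seq J) (P : pred J) (F : J -> H) :
  (forall j, P j -> R (F j)) -> R (\sum_(j <- s | P j) F j).
Proof. by move=> RF; elim/big_ind: _ => //; [exact: subring0|exact: subringD]. Qed.

(** The largest subset of [R] closed under truncations. *)
Definition truncation_core : set H := [set f | R f /\ forall m, R (truncation f m)].
Notation S := truncation_core.

(** Of two successive cuts only the higher one matters. *)
Lemma truncation_core_truncation f m : S f -> S (truncation f m).
Proof.
move=> [Rf Sf]; split=> [//|n]; have [mn|nm] := comparable_leP (ocmp m n).
  by rewrite truncation_truncation.
rewrite truncation_id// => v /supp_truncation[_]; exact: lt_trans.
Qed.

Lemma truncation_coreB f g : S f -> S g -> S (f - g).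
Proof.
move=> [Rf Sf] [Rg Sg]; split=> [|m]; first exact: subringB.
by rewrite truncationB; apply: subringB.
Qed.

(* Let [n] be the largest element of the support of [g] with [s + n <= m] for
   some [s] in the support of [f].  At [m], [f * g] has the same truncation as
   [f|s * g + (f - f|s) * g|n], whose second term lies entirely above [m]. *)
Lemma truncation_mul f g m : S f -> S g -> R (truncation (f * g) m).
Proof.
elim: (Acc_truncation f) => {}f _ IH Sf Sg.
pose D := [set n | supp g n /\ exists2 s, supp f s & s + n <= m].
have [D0|/set0P/negP/negPn/eqP D0] := pselect (D !=set0); last first.
  rewrite truncation_id; first by apply: subringM; [case: Sf|case: Sg].
  move=> _ /supp_mul[s fs [n gn <-]]; rewrite /above /= oltNge.
  apply/negP => snm; suff : D n by rewrite D0.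
  by split=> //; exists s.
have [|n [gn [s fs snm]] nmax] := rwo_supp g D _ D0; first by move=> ? [].
have -> : truncation (f * g) m =
    truncation (truncation f s * g) m +
    (f - truncation f s) * truncation g n.
  have -> : f * g = truncation f s * g + (f - truncation f s) * truncation g n
      + (f - truncation f s) * (g - truncation g n).
    by rewrite -addrA -mulrDr [truncation g n + _]addrC subrK -mulrDl addrC subrK.
  (* The product of the two remainders has exponents at most [s + n <= m]. *)
  rewrite !truncationD [X in _ + X]truncation_eq0 ?addr0; last first.
    move=> _ /supp_mul[x /supp_sub_truncation[_ xs] [y /supp_sub_truncation[_ yn] <-]].
    by apply: le_trans snm; exact: olerD.
  congr (_ + _); apply: truncation_id.
  move=> _ /supp_mul[x /supp_sub_truncation[fx xs] [y /supp_truncation[gy ny] <-]].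
  rewrite /above /= oltNge; apply/negP => xym.
  have /nmax : D y by split=> //; exists x.
  by rewrite oleNgt ny.
apply: subringD.
  apply: IH => //; first by exists s.
  exact: truncation_core_truncation.
apply: subringM; last by case: Sg.
by apply: subringB; case: Sf.
Qed.

Lemma truncation_coreM f g : S f -> S g -> S (f * g).
Proof.
move=> Sf Sg; split=> [|m]; last exact: truncation_mul.
by apply: subringM; [case: Sf|case: Sg].
Qed.

(** A cut either keeps a single term whole or kills it. *)
Lemma truncation_core_term (c : K) m : R (term c m) -> S (term c m).
Proof.
move=> Rt; split=> // n; have [nm|mn] := boolP (n < m).
  rewrite truncation_id// => v; rewrite /supp /=.
  by have [->|] := eqVneq v m; rewrite ?eqxx.
rewrite truncation_eq0; first exact: subring0.
move=> v; rewrite /supp /=; have [->|] := eqVneq v m; rewrite ?eqxx//.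
by rewrite oleNgt.
Qed.

Lemma truncation_core_subring : subring_closed (mem S).
Proof.
split=> [|f g|f g]; rewrite ?in_setE.
- by apply: truncation_core_term; exact: subring1.
- exact: truncation_coreB.
- exact: truncation_coreM.
Qed.

End Subring.
End Hahn.

(** * Sums of finite support in the coefficient field *)

Section FiniteSupportSums.
Context {K : realFieldType} {I : choiceType}.
Implicit Types F G : I -> K.

(** A sum over an infinite support has the default value 0, whence the finiteness hypotheses. *)
Lemma fsum_add F G :
  finite_set [set i | F i != 0] -> finite_set [set i | G i != 0] ->
  \sum_(i \in [set: I]) (F i + G i) =
  \sum_(i \in [set: I]) F i + \sum_(i \in [set: I]) G i.
Proof.
move=> finF finG.
have fin : finite_set ([set i | F i != 0] `|` [set i | G i != 0]).
  by rewrite finite_setU.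
have memD i : i \notin fset_set ([set i | F i != 0] `|` [set i | G i != 0]) ->
    F i = 0 /\ G i = 0.
  rewrite in_fset_set// notin_setE => /= FG.
  by split; apply: contrapT => /eqP Fi; apply: FG; [left|right].
rewrite !(fsbigTE (fset_set ([set i | F i != 0] `|` [set i | G i != 0]))).
- exact: big_split.
- by move=> i /memD[].
- by move=> i /memD[].
- by move=> i /memD[-> ->]; rewrite addr0.
Qed.

Lemma fsum_sum (J : Type) (s : seq J) (F : J -> I -> K) :
  (forall j, finite_set [set i | F j i != 0]) ->
  \sum_(i \in [set: I]) \sum_(j <- s) F j i =
  \sum_(j <- s) \sum_(i \in [set: I]) F j i.
Proof.
move=> finF; elim: s => [|j s IH].
  by rewrite big_nil; apply: fsbig1 => i _; rewrite big_nil.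
rewrite big_cons -IH -fsum_add//; first by apply: eq_fsbigr => i _; rewrite big_cons.
elim: s {IH} => [|k s IH].
  rewrite (_ : [set i | _] = set0); first exact: finite_set0.
  by apply/seteqP; split=> i //=; rewrite big_nil eqxx.
apply: sub_finite_set (_ : finite_set ([set i | F k i != 0] `|`
  [set i | \sum_(j <- s) F j i != 0])); last by rewrite finite_setU.
move=> i /=; rewrite big_cons.
by have [->|Fk] := eqVneq (F k i) 0; [rewrite add0r; right|left].
Qed.

End FiniteSupportSums.

(** * Summability and evaluation of restricted power series *)

Section Series.
Context {Lam : realFieldType} {K : realFieldType} {M : orderedLmodType Lam}.
Notation H := (hahn K M).
Implicit Types (f g h : H) (m v s : M) (A X : set M).

Lemma rwo_bigcup_fin (I : finType) (F : I -> set M) :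
  (forall i, rwo (F i)) -> rwo (\bigcup_i F i).
Proof.
move=> rF; suff P (s : seq I) : rwo [set x | exists2 i, i \in s & F i x].
  by apply: rwoS (P (enum I)) _ => x [i _ Fix]; exists i => //; rewrite mem_enum.
elim: s => [|i s IH]; first by apply: rwoS rwo0 _ => x [].
apply: rwoS (rwoU (rF i) IH) _ => x [j]; rewrite inE => /orP[/eqP->|js] Fj.
  by left.
by right; exists j.
Qed.

Lemma hsumE (I : choiceType) (F : I -> H) v : summable F ->
  hsum F v = \sum_(i \in [set: I]) F i v.
Proof. by rewrite /hsum; case: pselect. Qed.

(** At [v] only the exponents in the finite set [P] contribute, and for these only the indices in
    the finite set [Q]. Both sides are then finite double sums, taken in opposite orders. *)
Lemma hsum_mulE (I : choiceType) (F : I -> H) h v : summable F ->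
  (hsum F * h) v = \sum_(i \in [set: I]) (F i * h) v.
Proof.
move=> sF; have [rF finF] := sF.
have finP := rwo_convolution_finite v rF (rwo_supp h).
set P := [set _ | _] in finP.
have memP p : (\bigcup_i supp (F i)) p -> supp h (v - p) -> p \in fset_set P.
  by move=> Fp hp; rewrite in_fset_set// inE.
have finQ : finite_set (\bigcup_(p in P) [set i | supp (F i) p]).
  by apply: bigcup_finite.
set Q := \bigcup_(p in P) _ in finQ.
rewrite [LHS](@convE _ _ _ _ _ _ (fset_set P))// ?fset_uniq//; last first.
  move=> p; rewrite /supp /= hsumE// => /fsum_neq0[i Fip].
  by apply: memP; exists i.
have convF i : (F i * h) v = \sum_(p <- fset_set P) F i p * h (v - p).
  apply: convE; first exact: fset_uniq.
  by move=> p Fip; apply: memP; exists i.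
have QP i p : i \notin fset_set Q -> p \in fset_set P -> F i p = 0.
  rewrite !in_fset_set// notin_setE inE => nQ Pp.
  by apply: contrapT => /eqP Fip; apply: nQ; exists p.
rewrite (fsbigTE (fset_set Q)); last first.
  move=> i iQ; rewrite convF big_seq big1// => p pP.
  by rewrite (QP _ _ iQ pP) mul0r.
under [RHS]eq_bigr do rewrite convF.
rewrite exchange_big /=; apply: eq_big_seq => p pP.
rewrite hsumE// (fsbigTE (fset_set Q)); first by rewrite big_distrl.
by move=> i iQ; exact: QP iQ pP.
Qed.

(** The letter count [d] is recorded so that a bound on word lengths becomes a bound on degrees. *)
Definition spelled X d f := forall v, supp f v ->
  exists w, [/\ words X w, size w = d & \sum_(x <- w) x = v].

Lemma spelled1 X : spelled X 0 1.
Proof.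
move=> v; rewrite /supp /=; have [-> _|] := eqVneq v 0; last by rewrite eqxx.
by exists [::]; rewrite big_nil.
Qed.

Lemma spelledM X d e f g :
  spelled X d f -> spelled X e g -> spelled X (d + e) (f * g).
Proof.
move=> fX gX _ /supp_mul[x /fX[w1 [w1X <- <-]] [y /gX[w2 [w2X <- <-]] <-]].
exists (w1 ++ w2); rewrite size_cat big_cat; split=> // x'.
by rewrite mem_cat => /orP[/w1X|/w2X].
Qed.

Lemma spelledX X f d : supp f `<=` X -> spelled X d (f ^+ d).
Proof.
move=> fX; elim: d => [|d IH]; first exact: spelled1.
rewrite exprS -add1n; apply: spelledM => // v /fX Xv.
by exists [:: v]; rewrite big_seq1; split=> // x; rewrite inE => /eqP ->.
Qed.

Lemma spelled_prod X (J : Type) (s : seq J) (P : pred J)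
    (F : J -> H) (d : J -> nat) : (forall j, spelled X (d j) (F j)) ->
  spelled X (\sum_(j <- s | P j) d j) (\prod_(j <- s | P j) F j).
Proof.
move=> Fd; apply: (big_ind2 (fun f d => spelled X d f)) => //.
  exact: spelled1.
by move=> f d1 g d2; exact: spelledM.
Qed.

Definition bounded_by m f := forall v, supp f v -> v <= m.

Lemma bounded_by1 : bounded_by 0 1.
Proof. by move=> v; rewrite /supp /=; have [->//|_] := eqVneq v 0; rewrite eqxx. Qed.

Lemma bounded_byM m n f g :
  bounded_by m f -> bounded_by n g -> bounded_by (m + n) (f * g).
Proof. by move=> fm gn _ /supp_mul[x /fm xm [y /gn yn <-]]; exact: olerD. Qed.

Lemma bounded_byX m f d : bounded_by m f -> bounded_by (m *+ d) (f ^+ d).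
Proof.
move=> fm; elim: d => [|d IH]; first exact: bounded_by1.
by rewrite exprS mulrS; exact: bounded_byM.
Qed.

Lemma bounded_by_infinitesimal f d : infinitesimal f -> bounded_by 0 (f ^+ d).
Proof.
by move=> fi; rewrite -(mul0rn M d); apply: bounded_byX => v /fi /ltW.
Qed.

Context {n : nat}.
Notation index := {ffun 'I_n -> nat}.
Implicit Types (r : pseries K M n) (a : 'I_n -> H) (k : index) (i : 'I_n).

Definition series_supp r := \bigcup_k supp (r k).
Definition letters a := \bigcup_i supp (a i).
Definition monom a k := \prod_i a i ^+ k i.

Definition word_family A X (F : index -> H) := forall k v, supp (F k) v ->
  exists s w, [/\ A s, words X w, size w = (\sum_i k i)%N &
                s + \sum_(x <- w) x = v].

Lemma finite_degree_le N : finite_set [set k : index | (\sum_i k i <= N)%N].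
Proof.
pose e (k : {ffun 'I_n -> 'I_N.+1}) : index := [ffun i => val (k i)].
apply: sub_finite_set (_ : finite_set (range e)); last first.
  exact/finite_image/finite_finset.
move=> k /= kN; exists [ffun i => inord (k i)] => //.
apply/ffunP => i; rewrite !ffunE /= inordK// ltnS.
by apply: leq_trans kN; rewrite (bigD1 i)//= leq_addr.
Qed.

(** Neumann's lemma bounds the lengths of the words giving [v], hence the total degrees of the
    indices that contribute at [v]; only finitely many indices satisfy such a bound. *)
Lemma summable_word_family A X F : rwo A -> rwo X -> X `<=` [set x | x < 0] ->
  word_family A X F -> summable F.
Proof.
move=> rA rX Xneg FAX; have [rAX bAX] := neumann_negative rX Xneg rA.
split=> [|v].
  apply: rwoS rAX _ => v [k _ /FAX[s [w [As wX _ <-]]]].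
  by exists s => //; exists w.
have [N NP] := bAX v; apply: sub_finite_set (finite_degree_le N) => k /=.
by move=> /FAX[s [w [As wX <- sw]]]; exact: NP sw.
Qed.

Lemma word_familyM A X r (F : index -> H) :
  series_supp r `<=` A -> (forall k, spelled X (\sum_i k i) (F k)) ->
  word_family A X (fun k => r k * F k).
Proof.
move=> rA FX k _ /supp_mul[s rs [_ /FX[w [wX sw <-]] <-]].
by exists s, w; split=> //; apply: rA; exists k.
Qed.

Lemma spelled_monom a k : spelled (letters a) (\sum_i k i) (monom a k).
Proof. by apply: spelled_prod => i; apply: spelledX => v aiv; exists i. Qed.

Lemma rwo_letters a : rwo (letters a).
Proof. by apply: rwo_bigcup_fin => i; exact: rwo_supp. Qed.

Lemma letters_negative a : (forall i, infinitesimal (a i)) ->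
  letters a `<=` [set x | x < 0].
Proof. by move=> ai x [i _ /ai]. Qed.

Lemma summable_peval r a : restricted r -> (forall i, infinitesimal (a i)) ->
  summable (fun k => r k * monom a k).
Proof.
move=> rr ai; apply: (@summable_word_family (series_supp r) (letters a)) => //.
- exact: rwo_letters.
- exact: letters_negative.
- by apply: word_familyM => // k; exact: spelled_monom.
Qed.

Lemma pevalE r a v : restricted r -> (forall i, infinitesimal (a i)) ->
  peval r a v = \sum_(k \in [set: index]) (r k * monom a k) v.
Proof. by move=> rr ai; rewrite /peval hsumE//; exact: summable_peval. Qed.

Lemma supp_peval r a v : restricted r -> (forall i, infinitesimal (a i)) ->
  supp (peval r a) v -> exists s w,
    [/\ series_supp r s, words (letters a) w & s + \sum_(x <- w) x = v].
Proof.
move=> rr ai; rewrite /supp /= pevalE// => /fsum_neq0[k].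
have rA : series_supp r `<=` series_supp r by [].
move=> /(word_familyM rA (fun k => @spelled_monom a k)) [s [w [rs wa _ sw]]].
by exists s, w.
Qed.

Lemma peval_add r r1 r2 a : restricted r1 -> restricted r2 ->
  (forall i, infinitesimal (a i)) -> (forall k, r k = r1 k + r2 k) ->
  peval r a = peval r1 a + peval r2 a.
Proof.
move=> rr1 rr2 ai rE; have [_ fin1] := summable_peval rr1 ai.
have [_ fin2] := summable_peval rr2 ai.
have rr : restricted r.
  apply: rwoS (rwoU rr1 rr2) _ => v [k _]; rewrite rE /supp /= => r12.
  have [r1k|r1k] := eqVneq (r1 k v) 0; [right|left]; exists k => //.
  by move: r12; rewrite r1k add0r.
apply: hahnP => v; rewrite [RHS]/= !pevalE// -fsum_add; [|exact: fin1|exact: fin2].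
by apply: eq_fsbigr => k _; rewrite rE mulrDl.
Qed.

Lemma bounded_by_peval r a m : restricted r -> (forall i, infinitesimal (a i)) ->
  (forall k, bounded_by m (r k)) -> bounded_by m (peval r a).
Proof.
move=> rr ai rm v /(supp_peval rr ai)[s [w [[k _ rks] wa <-]]].
rewrite -[leRHS]addr0; apply: olerD; first exact: rm rks.
rewrite -[leRHS](mul0rn M (count (fun x => x <= 0) w)).
by apply: oler_sum_count => x /wa /(letters_negative ai) /ltW.
Qed.

Definition shift i l k : index := [ffun j => (k j + (j == i) * l)%N].

Lemma iter_pderiv i l r k :
  iter l (pderiv i) r k = r (shift i l k) *+ ((k i + l) ^_ l).
Proof.
elim: l k => [|l IH] k.
  rewrite /= ffactn0 mulr1n; congr (r _).
  by apply/ffunP => j; rewrite ffunE muln0 addn0.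
rewrite iterS /pderiv IH -mulrnA; congr (r _ *+ _).
  by apply/ffunP => j; rewrite !ffunE -addnA mulnS.
(* The factor [(k i).+1] from the outermost derivative is the last factor [k i + l.+1 - l] of the
   falling factorial. *)
by rewrite !ffunE eqxx addn1 addnS addSn ffactnSr -addSn addnK.
Qed.

Lemma supp_iter_pderiv i l r : series_supp (iter l (pderiv i) r) `<=` series_supp r.
Proof.
move=> v [k _]; rewrite /supp /= iter_pderiv hcoefMn => rv.
by exists (shift i l k) => //; apply: contra_neq rv => ->; rewrite mul0rn.
Qed.

Lemma restricted_iter_pderiv i l r :
  restricted r -> restricted (iter l (pderiv i) r).
Proof. by move=> rr; apply: rwoS rr _; exact: supp_iter_pderiv. Qed.

Lemma iter_pderiv_add i l r r1 r2 : (forall k, r k = r1 k + r2 k) ->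
  forall k, iter l (pderiv i) r k =
            iter l (pderiv i) r1 k + iter l (pderiv i) r2 k.
Proof. by move=> rE k; rewrite !iter_pderiv rE mulrnDl. Qed.

End Series.

(** * Taylor expansion in one argument, up to a cut *)

Section Taylor.
Context {Lam : realFieldType} {K : realFieldType} {M : orderedLmodType Lam}.
Notation H := (hahn K M).
Context {n : nat}.
Notation index := {ffun 'I_n -> nat}.
Variables (g : pseries K M n) (a : 'I_n -> H) (i : 'I_n) (b d : H).
Variables (m n0 s : M) (N : nat).
Hypothesis rg : restricted g.
Hypothesis ai : forall j, infinitesimal (a j).
Hypothesis aE : a i = b + d.
Hypothesis ba : supp b `<=` supp (a i).
Hypothesis da : supp d `<=` supp (a i).
Hypothesis n0_le0 : n0 <= 0.
Hypothesis dn0 : bounded_by n0 d.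
Hypothesis gs : forall k, bounded_by s (g k).
Hypothesis sm : s + n0 *+ N <= m.

Let rest (k : index) : H := \prod_(j | j != i) a j ^+ k j.
(** The part of degree [l] in [d] of the binomial expansion of [g k * monom a k]. For [l > k i] the
    truncated subtraction is harmless, the binomial coefficient being 0. *)
Let T l k : H := g k * (b ^+ (k i - l) * d ^+ l * rest k) *+ 'C(k i, l).
Let bi : infinitesimal b. Proof. by move=> v /ba /ai. Qed.
Let di : infinitesimal d. Proof. by move=> v /da /ai. Qed.
Let ai' j : infinitesimal (upd a i b j).
Proof. by rewrite /upd; case: eqP. Qed.

Lemma taylor_rest_bounded k : bounded_by 0 (rest k).
Proof.
rewrite /rest; elim/big_ind: _ => [|x y x0 y0|j _].
- exact: bounded_by1.
- by rewrite -(addr0 (0 : M)); exact: bounded_byM.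
- exact: bounded_by_infinitesimal.
Qed.

(** The coefficient is bounded by [s], the power of [d] by [n0 *+ l <= n0 *+ N], and the other
    factors by 0. *)
Lemma taylor_term_small l k v : (N <= l)%N -> m < v -> T l k v = 0.
Proof.
move=> Nl mv; have : bounded_by m (g k * (b ^+ (k i - l) * d ^+ l * rest k)).
  have : bounded_by (s + (0 + n0 *+ l + 0))
      (g k * (b ^+ (k i - l) * d ^+ l * rest k)).
    have b1 := bounded_by_infinitesimal (d := k i - l) bi.
    have b2 := bounded_byX (d := l) dn0.
    have b3 := bounded_byM (bounded_byM b1 b2) (@taylor_rest_bounded k).
    exact: bounded_byM (@gs k) b3.
  rewrite add0r addr0 => gbd x /gbd /le_trans; apply; apply: le_trans sm.
  by apply: olerD2l; exact: olerMn.
move=> /(_ v) gm; rewrite /T hcoefMn; apply/eqP; apply: contraTT mv => Tv.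
rewrite -oleNgt; apply: gm; rewrite /supp /mkset; apply: contra_neq Tv => ->.
exact: mul0rn.
Qed.

Lemma spelled_taylor_rest (k : index) :
  spelled (letters a) (\sum_(j | j != i) k j) (rest k).
Proof. by apply: spelled_prod => j; apply: spelledX => v aj; exists j. Qed.

(** A nonzero [T l k] has [l <= k i], so the powers of [b] and [d] together spell exactly [k i]
    letters of [a i], and [T l] is a word family. *)
Lemma taylor_finite l v : finite_set [set k | T l k v != 0].
Proof.
have ra : rwo (letters a) by exact: rwo_letters.
suff TF : word_family (series_supp g) (letters a) (T l).
  by have [_] := summable_word_family rg ra (letters_negative ai) TF; apply.
move=> k v'; rewrite /supp /mkset /T hcoefMn => Tk.
have lk : (l <= k i)%N.
  by rewrite leqNgt; apply: contra Tk => kl; rewrite bin_small// mulr0n.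
have {Tk} /supp_mul[x gx [y + <-]] :
    supp (g k * (b ^+ (k i - l) * d ^+ l * rest k)) v'.
  by rewrite /supp /mkset; apply: contra_neq Tk => ->; rewrite mul0rn.
have sp : spelled (letters a) (k i - l + l + \sum_(j | j != i) k j)
    (b ^+ (k i - l) * d ^+ l * rest k).
  apply: spelledM; last exact: spelled_taylor_rest.
  by apply: spelledM; apply: spelledX => u; [move=> /ba|move=> /da]; exists i.
move=> /sp[w [wX sw <-]]; exists x, w; split=> //; first by exists k.
by rewrite sw subnK// [RHS](bigD1 i).
Qed.

Lemma taylor_monom (k : index) : g k * monom a k = \sum_(l < (k i).+1) T l k.
Proof.
rewrite /monom (bigD1 i)//= aE exprDn big_distrl big_distrr /=.
by apply: eq_bigr => l _; rewrite /T mulrnAl mulrnAr.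
Qed.

(** The binomial sum stops at [k i], the Taylor sum before [N]. Both extend by zeros to [top]: by
    vanishing binomial coefficients past [k i], and by [taylor_term_small] from [N] on. *)
Lemma taylor_coef (k : index) v : m < v -> (g k * monom a k) v = \sum_(l < N) T l k v.
Proof.
move=> mv; rewrite taylor_monom hcoef_sum.
rewrite -!(big_mkord xpredT (fun l => T l k v)).
have T0 l : (k i < l)%N -> T l k v = 0.
  by move=> kl; rewrite /T hcoefMn bin_small// mulr0n.
pose top := maxn (k i).+1 N.
transitivity (\sum_(0 <= l < top) T l k v).
  rewrite (big_cat_nat (leq0n (k i).+1) (leq_maxl _ N)) /=.
  rewrite [X in _ = _ + X]big_nat_cond [X in _ = _ + X]big1 ?addr0// => l.
  by case/andP => /andP[kl _] _; exact: T0.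
rewrite (big_cat_nat (leq0n N) (leq_maxr (k i).+1 _)) /=.
rewrite [X in _ + X]big_nat_cond [X in _ + X]big1 ?addr0// => l.
by case/andP => /andP[Nl _] _; exact: taylor_term_small.
Qed.

Lemma shift_at l (k : index) : shift i l k i = (k i + l)%N.
Proof. by rewrite ffunE eqxx mul1n. Qed.

(** The falling factorial left by the derivatives is a binomial coefficient times the factorial of
    [l], and the constant cancels this factorial. *)
Lemma taylor_shift l (k : index) :
  iter l (pderiv i) g k * monom (upd a i b) k * (hconst M (l`!%:R^-1) * d ^+ l) =
  T l (shift i l k).
Proof.
have restE : \prod_(j | j != i) upd a i b j ^+ k j = rest (shift i l k).
  apply: eq_bigr => j /negPf ji; rewrite /upd ji /shift ffunE ji.
  by rewrite mul0n addn0.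
rewrite iter_pderiv /monom (bigD1 i)//= restE {1}/upd eqxx /T.
rewrite shift_at addnK -bin_ffact.
set c := hconst M _; have cl : c *+ l`! = 1.
  by rewrite -hconstMn -[_^-1 *+ _]mulr_natr mulVf// pnatr_eq0 -lt0n fact_gt0.
rewrite mulrnA -[RHS]mulr1 -cl.
rewrite !(mulrnAl, mulrnAr) -[RHS]mulrnA mulnC mulrnA; congr (_ *+ _ *+ _).
by rewrite -!mulrA; congr (_ * (_ * _)); rewrite [c * _]mulrC mulrCA.
Qed.

Lemma taylor_sum l v :
  (peval (iter l (pderiv i) g) (upd a i b) * (hconst M (l`!%:R^-1) * d ^+ l)) v =
  \sum_(k \in [set: index]) T l k v.
Proof.
rewrite hsum_mulE; last first.
  by apply: summable_peval => //; exact: restricted_iter_pderiv.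
rewrite (eq_fsbigr (fun k => T l (shift i l k) v)); last first.
  by move=> k _; rewrite -taylor_shift.
(* The indices with [l <= k i] are exactly the shifts by [l]; at all others [T l] vanishes. *)
transitivity (\sum_(k \in [set k : index | (l <= k i)%N]) T l k v); last first.
  apply: fsbig_widen => [//|k [_ /= /negP]]; rewrite -ltnNge => kl.
  by rewrite /T hcoefMn bin_small.
apply/esym; apply: (reindex_fsbig (shift i l)); split.
- by move=> k _; rewrite /= shift_at leq_addl.
- move=> k k' _ _ /ffunP kk'; apply/ffunP => j.
  by have := kk' j; rewrite !ffunE => /addIn.
- move=> k /= lk; exists [ffun j => (k j - (j == i) * l)%N] => //.
  apply/ffunP => j; rewrite !ffunE; case: (eqVneq j i) => [->|_].
    by rewrite mul1n subnK.
  by rewrite mul0n subn0 addn0.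
Qed.

Lemma truncation_peval_taylor :
  truncation (peval g a) m = truncation (\sum_(l < N)
    peval (iter l (pderiv i) g) (upd a i b) * (hconst M (l`!%:R^-1) * d ^+ l)) m.
Proof.
apply: hahnP => v /=; case: ifP => // mv.
rewrite pevalE// hcoef_sum.
rewrite (eq_fsbigr (fun k => \sum_(l < N) T l k v)); last first.
  by move=> k _; exact: taylor_coef.
rewrite fsum_sum; last by move=> l; exact: taylor_finite.
by apply: eq_bigr => l _; rewrite taylor_sum.
Qed.

End Taylor.

(** * Truncations of the values of series in [L] *)

Section TruncationOfValues.
Context {Lam : realFieldType} {K : realFieldType} {M : orderedLmodType Lam}.
Notation H := (hahn K M).
Variable L : forall n : nat, set (pseries K M n).
Hypothesis Lrestricted : forall n (r : pseries K M n), L r -> restricted r.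
Hypothesis Lderiv : closed_under_pderiv L.
Hypothesis Ltrunc : closed_under_ptruncation L.
Variable R : set H.
Hypothesis R_subring : subring_closed (mem R).
Hypothesis R_peval : closed_under_peval L R.
Hypothesis R_const : range (@hconst Lam K M) `<=` R.
Notation S := (truncation_core R).

Lemma iter_pderiv_closed n (i : 'I_n) l (r : pseries K M n) :
  L r -> L (iter l (pderiv i) r).
Proof. by move=> Lr; elim: l => [//|l]; exact: Lderiv. Qed.

Lemma truncation_coreX f l : S f -> S (f ^+ l).
Proof.
move=> Sf; elim: l => [|l IH].
  by apply: truncation_core_term => //; exact: subring1.
by rewrite exprS; exact: truncation_coreM.
Qed.

Lemma Acc_ptruncation n (r : pseries K M n) : restricted r ->
  Acc (proper_cut (@ptruncation Lam K M n) series_supp) r.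
Proof.
move=> rr; apply: (Acc_proper_cut (sup := series_supp) _ _ rr) => r' m.
  move=> v [k _ /supp_truncation[rk mv]].
  by split=> //; exists k.
by move=> m' mm'; apply/funext => k; exact: truncation_truncation.
Qed.

Lemma ptruncation_split n (r : pseries K M n) s k :
  r k = ptruncation r s k + (r k - ptruncation r s k).
Proof. by rewrite addrC subrK. Qed.

Lemma truncation_peval n (a : 'I_n -> H) (r : pseries K M n) m : L r ->
  (forall i, S (a i) /\ infinitesimal (a i)) -> R (truncation (peval r a) m).
Proof.
move=> Lr Sa.
have acc_a := Acc_upd_rel (fun i => Acc_truncation (a i)).
(* The outer induction keeps [r] and [m] general: it is applied to derivatives of [r] and of its
   truncation, at every cut. *)
elim: acc_a r m Lr Sa => {}a _ IHa r m Lr Sa.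
have acc_r := Acc_ptruncation (Lrestricted Lr).
elim: acc_r Lr => {}r _ IHr Lr.
have ai i : infinitesimal (a i) by case: (Sa i).
have rr := Lrestricted Lr.
(* The case [s <= m] stands apart because the supports of the arguments may all be empty. *)
have [[s [rs small]]|large] := pselect (exists s, series_supp r s /\
    (s <= m \/ exists i n0 N, supp (a i) n0 /\ s + n0 *+ N <= m)); last first.
  rewrite truncation_id.
    by apply: R_peval => // i; have [[? _] ?] := Sa i.
  move=> _ /(supp_peval rr ai)[s [w [rs wa <-]]].
  rewrite /above /= oltNge; apply/negP => sm; apply: large; exists s; split=> //.
  have [w0|w0] := eqVneq w [::].
    by left; rewrite w0 big_nil addr0 in sm.
  (* The least letter, repeated as often as the word has letters, still gives a sum at most [m]. *)
  right; have [n0 n0w n0sum] := seq_min_sum w0.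
  have [i _ ain0] := wa _ n0w; exists i, n0, (size w); split=> //.
  by apply: le_trans sm; exact: olerD2l.
have Lrs : L (ptruncation r s) by exact: Ltrunc.
have rrs := Lrestricted Lrs.
pose g : pseries K M n := fun k => r k - ptruncation r s k.
have gs k : bounded_by s (g k) by move=> v /supp_sub_truncation[].
have rg : restricted g.
  by apply: rwoS rr _ => v [k _ /supp_sub_truncation[rk _]]; exists k.
rewrite (peval_add rrs rg ai (ptruncation_split r s)) truncationD.
apply: (subringD R_subring); first by apply: IHr => //; exists s.
case: small => [sm|[i [n0 [N [ain0 sm]]]]].
  rewrite truncation_eq0; first exact: subring0.
  by move=> v /(bounded_by_peval rg ai gs) /le_trans; apply.
pose b := truncation (a i) n0.
have Sa' j : S (upd a i b j) /\ infinitesimal (upd a i b j).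
  rewrite /upd; case: eqP => // _; split.
    by apply: truncation_core_truncation => //; case: (Sa i).
  exact: infinitesimal_truncation.
have IHb r' m' : L r' -> R (truncation (peval r' (upd a i b)) m').
  move=> Lr'; apply: IHa => //; exists i, b.
  by split=> //; [rewrite mem_enum|exists n0].
rewrite (@truncation_peval_taylor _ _ _ _ g a i b (a i - b) m n0 s N) //.
- rewrite truncation_sum; apply: subring_sum => // l _.
  apply: truncation_mul => //; last first.
    apply: truncation_coreM => //.
      by apply: truncation_core_term => //; apply: R_const; exists (l`!%:R^-1).
    apply: truncation_coreX; apply: truncation_coreB => //; first by case: (Sa i).
    by have [] := Sa' i; rewrite /upd eqxx.
  have ai' j : infinitesimal (upd a i b j) by case: (Sa' j).
  (* The series [g] need not lie in [L], but its derivatives are differences of derivatives of two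
     members of [L]. *)
  have -> : peval (iter l (pderiv i) g) (upd a i b) =
      peval (iter l (pderiv i) r) (upd a i b) -
      peval (iter l (pderiv i) (ptruncation r s)) (upd a i b).
    apply/eqP; rewrite eq_sym subr_eq addrC; apply/eqP; apply: peval_add => //.
    + exact: restricted_iter_pderiv.
    + exact: restricted_iter_pderiv.
    + by apply: iter_pderiv_add => k; exact: ptruncation_split.
  have S_peval r' : L r' -> S (peval r' (upd a i b)).
    move=> Lr'; split=> [|m']; last exact: IHb.
    by apply: R_peval => // j; have [[? _] ?] := Sa' j.
  by apply: truncation_coreB => //; apply: S_peval; exact: iter_pderiv_closed.
- by rewrite addrC subrK.
- by move=> v /supp_truncation[].
- by move=> v /supp_sub_truncation[].
- exact/ltW/(ai i).
- by move=> v /supp_sub_truncation[].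
Qed.

End TruncationOfValues.

(** * The generated subring *)

Theorem theoremB (Lam : realFieldType) (K : powFieldType Lam)
    (M : orderedLmodType Lam) (L : forall n : nat, set (pseries K M n))
    (Lrestricted : forall n (r : pseries K M n), L n r -> restricted r)
    (Lderiv : closed_under_pderiv L)
    (Ltrunc : closed_under_ptruncation L) :
  closed_under_truncation (generated_subring L).
Proof.
set R := generated_subring L.
have gen_sub (T : set (hahn K M)) : subring_closed (mem T) ->
    closed_under_peval L T ->
    range (@hconst Lam K M) `|` range (@monomial Lam K M) `<=` T -> R `<=` T.
  by move=> Tr Tp Tg f; apply; split.
have R_subring : subring_closed (mem R).
  split=> [|f g|f g]; rewrite ?in_setE.
  - by move=> T [[Tr _] _]; exact: subring1.
  - move=> Rf Rg T TP.
    by have [[Tr _] _] := TP; apply: subringB => //; [exact: Rf|exact: Rg].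
  - move=> Rf Rg T TP.
    by have [[Tr _] _] := TP; apply: subringM => //; [exact: Rf|exact: Rg].
have R_peval : closed_under_peval L R.
  move=> n r a Lr Ra T TP; have [[_ Tp] _] := TP.
  by apply: Tp => // i; have [Rai ?] := Ra i; split=> //; exact: Rai.
have R_gen : range (@hconst Lam K M) `|` range (@monomial Lam K M) `<=` R.
  by move=> f fG T [_]; apply.
(* By minimality of [R], its core need only be a subring that contains the generators and is closed
   under evaluation. *)
have RS : R `<=` truncation_core R.
  apply: gen_sub.
  - exact: truncation_core_subring.
  - move=> n r a Lr Sa; split=> [|m].
      by apply: R_peval => // i; have [[? _] ?] := Sa i.
    have R_const : range (@hconst Lam K M) `<=` R.
      by apply: subset_trans R_gen => f; left.
    refine (truncation_peval Lrestricted Lderiv Ltrunc R_subring R_peval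
      R_const m Lr Sa).
  - move=> _ [[c _ <-]|[m _ <-]]; apply: (truncation_core_term R_subring);
      apply: R_gen.
      by left; exists c.
    by right; exists m.
by move=> f m /RS[].
Qed.
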